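(* Let $I$ be a proper monomial ideal in a polynomial ring $R$ in finitely many variables over a field. Let $C=\{c_1, \ldots, c_r\}$ be a set of distinct variables of $R$, and let $B=\{x_1, \ldots, x_{q-1}, y_1, \ldots, y_{q-1}\}$ be a collection of (not necessarily distinct) variables of $R$ disjoint from $C$, with the possible exception that $c_1=y_{q-1}$ is allowed. Fix a term order $>$ on $R$ such that $x_i > y_i$ for all $i$, $x_i > x_j$ for all $i < j$, and $c_1>c_i$ for all $2\leq i \leq r$. Set $f_i=x_i+y_i$ for all $1\leq i \leq q-1$ and let $f_{q}=c_1+\cdots +c_r$. Then $f_1, \ldots, f_{q}$ is a regular sequence on $R/I$ if and only if $f_1, \ldots, f_q$ is an initially regular sequence on $R/I$ (with respect to $>$).
   Context: $\mathfrak m$ is the ideal of $R$ generated by all the variables. A term order is a monomial order (a total order on monomials, compatible with multiplication, with $1$ smallest), and $\mathrm{in}(J)$ is the initial ideal of $J$ with respect to the fixed term order. An element $f\in\mathfrak m$ is regular on $R/J$ if it is a non-zerodivisor on $R/J$. A sequence $f_1,\dots,f_q\in\mathfrak m$ is a regular sequence on $R/I$ if $f_i$ is regular on $R/(I,f_1,\dots,f_{i-1})$ for each $i$. It is an initially regular sequence on $R/I$ ($I$ proper, $f_i$ nonconstant) if for each $i=1,\dots,q$, $f_i$ is regular on $R/I_i$, where $I_1=\mathrm{in}(I)$ and $I_i=\mathrm{in}\big((I_{i-1},f_{i-1})\big)$ for $i\ge 2$. *)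

(* Defs.v *)
From HB Require Import structures.
From mathcomp Require Import all_boot all_order all_algebra.
From mathcomp Require Import mpoly.

Set Implicit Arguments.
Unset Strict Implicit.
Unset Printing Implicit Defensive.

Import GRing.Theory.
Local Open Scope ring_scope.

(* Subsets of a ring are Prop-valued predicates: membership in the ideals     *)
(* below is not decidable in general, so the boolean ideals of ring_quotient  *)
(* do not apply.                                                              *)

Definition ideal_gen (R : comNzRingType) (S : R -> Prop) : R -> Prop :=
  fun p => exists (k : nat) (a g : 'I_k -> R),
    (forall i, S (g i)) /\ p = \sum_(i < k) a i * g i.

(* The ideal (J, f_1, ..., f_k). *)
Definition ideal_adjoin (R : comNzRingType) (J : R -> Prop) (fs : seq R) :
    R -> Prop :=
  ideal_gen (fun p => J p \/ p \in fs).

Definition ideal_proper (R : comNzRingType) (J : R -> Prop) : Prop := ~ J 1.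

Section Polynomials.
Variables (F : fieldType) (n : nat).
Local Notation R := {mpoly F[n]}.

Definition var_ideal : R -> Prop :=
  ideal_gen (fun p : R => exists i : 'I_n, p = 'X_i).

Definition monomial_ideal (I : R -> Prop) : Prop :=
  exists M : 'X_{1..n} -> Prop, forall p : R,
    I p <-> ideal_gen (fun g : R => exists2 m, M m & g = 'X_[m]) p.

(* Monomials are identified with their exponent vectors, so that the product  *)
(* of monomials is (_ + _)%MM and the monomial 1 is 0%MM.                     *)
Definition term_order (le : rel 'X_{1..n}) : Prop :=
  [/\ [/\ reflexive le, antisymmetric le, transitive le & total le],
      forall m m1 m2 : 'X_{1..n}, le m1 m2 -> le (m + m1)%MM (m + m2)%MM
    & forall m : 'X_{1..n}, le 0%MM m].

Definition var_gt (le : rel 'X_{1..n}) (i j : 'I_n) : Prop :=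
  le U_(j)%MM U_(i)%MM /\ i != j.

Definition initial_monomial (le : rel 'X_{1..n}) (p : R) (m : 'X_{1..n}) :
    Prop :=
  m \in msupp p /\ forall m', m' \in msupp p -> le m' m.

(* No coefficient is kept: over a field, initial terms and initial monomials  *)
(* generate the same ideal.  The polynomial 0 has no initial monomial.        *)
Definition initial_ideal (le : rel 'X_{1..n}) (J : R -> Prop) : R -> Prop :=
  ideal_gen (fun g : R =>
    exists p m, [/\ J p, initial_monomial le p m & g = 'X_[m]]).

Definition regular_on (J : R -> Prop) (f : R) : Prop :=
  var_ideal f /\ forall g : R, J (f * g) -> J g.

(* Sequences are 0-indexed: f_(i+1) is fs`_i. *)
Definition regular_sequence (I : R -> Prop) (fs : seq R) : Prop :=
  forall i, (i < size fs)%N -> regular_on (ideal_adjoin I (take i fs)) fs`_i.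

(* I_(i+1), i.e. in(I) for i = 0 and in((I_i, f_i)) afterwards. *)
Fixpoint iterated_initial (le : rel 'X_{1..n}) (I : R -> Prop) (fs : seq R)
    (i : nat) : R -> Prop :=
  if i is j.+1 then
    initial_ideal le (ideal_adjoin (iterated_initial le I fs j) [:: fs`_j])
  else initial_ideal le I.

(* 1 < msize f says that f has positive degree. *)
Definition initially_regular_sequence (le : rel 'X_{1..n}) (I : R -> Prop)
    (fs : seq R) : Prop :=
  [/\ ideal_proper I,
      forall f, f \in fs -> (1 < msize f)%N
    & forall i, (i < size fs)%N ->
        regular_on (iterated_initial le I fs i) fs`_i].

(* The sequence x_1 + y_1, ..., x_p + y_p, c_1 + ... + c_r. *)
Definition linear_sums (p r : nat) (x y : 'I_p -> 'I_n) (c : 'I_r -> 'I_n) :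
    seq R :=
  rcons [seq 'X_(x i) + 'X_(y i) | i <- enum 'I_p] (\sum_(j < r) 'X_(c j)).

End Polynomials.

(* Main.v *)
Require Import Defs.
From HB Require Import structures.
From mathcomp Require Import all_boot all_order all_algebra.
From mathcomp Require Import mpoly ring.

Set Implicit Arguments.
Unset Strict Implicit.
Unset Printing Implicit Defensive.

Import GRing.Theory.
Local Open Scope ring_scope.

(* Since x_i > y_i and x_i > x_j for i < j, the variable x_i can be eliminated *)
(* at the i-th step by x_i -> - y_i, and it occurs in no later term of the     *)
(* sequence.  Modulo signs, this elimination maps monomials to monomials, so   *)
(* if L is a monomial ideal then (L, x_i + y_i) and its initial ideal contain  *)
(* the same polynomials free of x_i.  By induction, (I, f_1, ..., f_k) and     *)
(* I_(k+1) contain the same polynomials free of x_1, ..., x_k, and modulo      *)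
(* either ideal every polynomial is congruent to such a polynomial: both       *)
(* quotients are the same quotient of the smaller polynomial ring, in which    *)
(* f_(k+1) lies.  Hence f_(k+1) is regular on one iff it is on the other.      *)

(** The bridge between the two sequences is [agree_off]: [agree_step] carries it across one pair x_i
    + y_i, and [regular_agree] turns it into equivalence of regularity. The substance of a step is
    [initial_adjoin], which rests on two facts about the substitution X_i -> - X_j: it takes an
    element of (L, f) to a polynomial all of whose monomials lie in (L, f) ([adjoin_elim_supp]), and
    an initial monomial free of X_i survives it ([initial_elim]). The order on the variables and the
    condition on B and C keep each f_(k+1) free of the variables already eliminated. *)

Section Ideals.
Variable R : comNzRingType.
Implicit Types (J : R -> Prop) (S : R -> Prop) (p : R).

Definition is_ideal J : Prop :=
  [/\ J 0, forall p1 p2, J p1 -> J p2 -> J (p1 + p2)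
    & forall p1 p2, J p2 -> J (p1 * p2)].

Lemma ideal_sum J (T : eqType) (s : seq T) (G : T -> R) :
  is_ideal J -> (forall i, i \in s -> J (G i)) -> J (\sum_(i <- s) G i).
Proof. by move=> [J0 JD _] JG; rewrite big_seq; apply: big_ind. Qed.

Lemma ideal_opp J p : is_ideal J -> J p -> J (- p).
Proof. by case=> _ _ JM /(JM (-1)); rewrite mulN1r. Qed.

Lemma ideal_sub J p1 p2 : is_ideal J -> J p1 -> J p2 -> J (p1 - p2).
Proof. by move=> idJ J1 /(ideal_opp idJ); case: idJ => _ JD _; apply: JD. Qed.

Lemma ideal_congr J p1 p2 : is_ideal J -> J (p1 - p2) -> J p1 <-> J p2.
Proof.
move=> idJ J12; split=> [J1|J2].
  by rewrite -[p2](subKr p1); apply: ideal_sub.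
by rewrite -[p1](subrK p2); case: idJ => _ JD _; apply: JD.
Qed.

Lemma ideal_gen_is_ideal S : is_ideal (ideal_gen S).
Proof.
split.
- by exists 0%N, (fun=> 0), (fun=> 0); split=> [[]|] //; rewrite big_ord0.
- move=> _ _ [k1 [a1 [g1 [S1 ->]]]] [k2 [a2 [g2 [S2 ->]]]].
  pose glue (h1 : 'I_k1 -> R) (h2 : 'I_k2 -> R) i :=
    match split i with inl j => h1 j | inr j => h2 j end.
  exists (k1 + k2)%N, (glue a1 a2), (glue g1 g2); split=> [i|].
    by rewrite /glue; case: (split i).
  rewrite big_split_ord; congr (_ + _); apply: eq_bigr => i _.
    by rewrite /glue (unsplitK (inl i)).
  by rewrite /glue (unsplitK (inr i)).
- move=> p _ [k [a [g [Sg ->]]]].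
  exists k, (fun i => p * a i), g; split=> //.
  by rewrite mulr_sumr; apply: eq_bigr => i _; rewrite mulrA.
Qed.

Lemma mem_ideal_gen S p : S p -> ideal_gen S p.
Proof.
move=> Sp; exists 1%N, (fun=> 1), (fun=> p).
by split=> //; rewrite big_ord1 mul1r.
Qed.

Lemma ideal_gen_min S J p :
  is_ideal J -> (forall g, S g -> J g) -> ideal_gen S p -> J p.
Proof.
move=> idJ SJ [k [a [g [Sg ->]]]]; apply: ideal_sum => // i _.
by case: idJ => _ _ JM; apply/JM/SJ.
Qed.

Lemma ideal_adjoin_is_ideal J fs : is_ideal (ideal_adjoin J fs).
Proof. exact: ideal_gen_is_ideal. Qed.

Lemma ideal_adjoin_nil J p : is_ideal J -> ideal_adjoin J [::] p <-> J p.
Proof.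
move=> idJ; split; last by move=> Jp; apply: mem_ideal_gen; left.
by apply: ideal_gen_min => // g [].
Qed.

Lemma ideal_adjoin_rcons J fs f p :
  ideal_adjoin J (rcons fs f) p <->
  ideal_adjoin (ideal_adjoin J fs) [:: f] p.
Proof.
split; apply: ideal_gen_min; try exact: ideal_adjoin_is_ideal.
  move=> g [Jg|]; first by apply: mem_ideal_gen; left; apply: mem_ideal_gen; left.
  rewrite mem_rcons inE => /orP[gf|gfs]; apply: mem_ideal_gen.
    by right; rewrite inE.
  by left; apply: mem_ideal_gen; right.
move=> g [|]; last first.
  by rewrite inE => gf; apply: mem_ideal_gen; right; rewrite mem_rcons inE gf.
apply: ideal_gen_min; first exact: ideal_adjoin_is_ideal.
move=> h [Jh|hfs]; apply: mem_ideal_gen; first by left.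
by right; rewrite mem_rcons inE hfs orbT.
Qed.

(** Multiples of [f] add up to one multiple and [J] absorbs the rest, so a single coefficient [h]
    suffices. *)
Lemma ideal_adjoin1 J f p : is_ideal J ->
  ideal_adjoin J [:: f] p <-> exists h, J (p - h * f).
Proof.
move=> idJ; split; last first.
  move=> [h Jh]; rewrite -[p](subrK (h * f)).
  have [_ adjD adjM] := ideal_adjoin_is_ideal J [:: f].
  apply: adjD; first by apply: mem_ideal_gen; left.
  by apply: adjM; apply: mem_ideal_gen; right; rewrite inE.
have [J0 JD JM] := idJ.
apply: (@ideal_gen_min _ (fun p => exists h, J (p - h * f))); first split.
- by exists 0; rewrite mul0r subrr.
- move=> p1 p2 [h1 J1] [h2 J2]; exists (h1 + h2).
  by rewrite mulrDl opprD addrACA; apply: JD.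
- by move=> p1 p2 [h J2]; exists (p1 * h); rewrite -mulrA -mulrBr; apply: JM.
move=> g [Jg|]; first by exists 0; rewrite mul0r subr0.
by rewrite inE => /eqP ->; exists 1; rewrite mul1r subrr.
Qed.

End Ideals.

(** * Monomial ideals and initial ideals *)

Section Monomials.
Variables (F : fieldType) (n : nat).
Local Notation R := {mpoly F[n]}.
Implicit Types (J L : R -> Prop) (M : 'X_{1..n} -> Prop) (p f : R).
Implicit Types (S : 'I_n -> Prop) (m : 'X_{1..n}).

Lemma ideal_supp J p :
  is_ideal J -> (forall m, m \in msupp p -> J 'X_[m]) -> J p.
Proof.
move=> idJ Jp; rewrite [p]mpolyE; apply: ideal_sum => // m /Jp.
by case: idJ => _ _ JM; rewrite -mul_mpolyC; apply: JM.
Qed.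

(** This is the largest monomial ideal inside [J]; that it is an ideal lets [adjoin_elim_supp] check
    generators only. *)
Lemma supp_ideal J : is_ideal J ->
  is_ideal (fun p => forall m, m \in msupp p -> J 'X_[m]).
Proof.
move=> [J0 JD JM]; split.
- by move=> m; rewrite msupp0.
- by move=> p1 p2 J1 J2 m /msuppD_le; rewrite mem_cat => /orP[/J1|/J2].
- move=> p1 p2 J2 m /msuppM_le /allpairsP[[m1 m2] /= [_ /J2 Jm2 ->]].
  by rewrite mpolyXD; apply: JM.
Qed.

Lemma mem_gen_monomials M p m :
  ideal_gen (fun g : R => exists2 m0, M m0 & g = 'X_[m0]) p ->
  m \in msupp p -> exists2 m0, M m0 & (m0 <= m)%MM.
Proof.
have : is_ideal (fun p : R =>
    forall m, m \in msupp p -> exists2 m0, M m0 & (m0 <= m)%MM).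
  split=> [m'|p1 p2 IH1 IH2 m'|p1 p2 IH2 m']; first by rewrite msupp0.
    by move/msuppD_le; rewrite mem_cat => /orP[/IH1|/IH2].
  move=> /msuppM_le /allpairsP[[m1 m2] /= [_ /IH2[m0 Mm0 le0] ->]].
  by exists m0 => //; apply: (lepm_trans le0); apply: lem_addl.
move=> /ideal_gen_min H /H; apply=> g [m0 Mm0 ->] m'.
by rewrite msuppX inE => /eqP ->; exists m0 => //; apply: lepm_refl.
Qed.

Lemma monomial_ideal_is_ideal J : monomial_ideal J -> is_ideal J.
Proof.
case=> M JE; have [g0 gD gM] := ideal_gen_is_ideal
  (fun g : R => exists2 m, M m & g = 'X_[m]).
split; first exact/JE.
  by move=> p1 p2 /JE J1 /JE J2; apply/JE/gD.
by move=> p1 p2 /JE J2; apply/JE/gM.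
Qed.

Lemma monomial_ideal_supp J p m :
  monomial_ideal J -> J p -> m \in msupp p -> J 'X_[m].
Proof.
move=> monJ; have [_ _ JM] := monomial_ideal_is_ideal monJ.
case: monJ => M JE /JE Jp /(mem_gen_monomials Jp)[m0 Mm0 /submK <-].
by rewrite mpolyXD; apply/JM/JE/mem_ideal_gen; exists m0.
Qed.

Variable le : rel 'X_{1..n}.
Hypothesis le_term_order : term_order le.

Lemma initial_ideal_monomial J : monomial_ideal (initial_ideal le J).
Proof.
exists (fun m => exists2 p, J p & initial_monomial le p m) => p.
split; apply: ideal_gen_min; try exact: ideal_gen_is_ideal.
  by move=> _ [p' [m [Jp' ini ->]]]; apply: mem_ideal_gen; exists m => //; exists p'.
by move=> _ [m [p' Jp' ini] ->]; apply: mem_ideal_gen; exists p', m.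
Qed.

Lemma initial_monomialX m : initial_monomial le ('X_[m] : R) m.
Proof.
case: le_term_order => -[le_refl _ _ _] _ _.
by split=> [|m']; rewrite msuppX inE // => /eqP ->; apply: le_refl.
Qed.

Lemma initial_ideal_mem_monomial J m : J 'X_[m] -> initial_ideal le J 'X_[m].
Proof.
move=> Jm; apply: mem_ideal_gen; exists 'X_[m], m.
by split=> //; apply: initial_monomialX.
Qed.

(** Every monomial of an element of a monomial ideal, the initial one included, lies in the ideal.
    This starts the induction. *)
Lemma initial_monomial_ideal J p :
  monomial_ideal J -> initial_ideal le J p <-> J p.
Proof.
move=> monJ; split; last first.
  move=> Jp; apply: ideal_supp; first exact: ideal_gen_is_ideal.
  move=> m mp; apply: initial_ideal_mem_monomial.
  exact: monomial_ideal_supp mp.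
apply: ideal_gen_min; first exact: monomial_ideal_is_ideal.
by move=> _ [p' [m [Jp' [mp' _] ->]]]; apply: monomial_ideal_supp mp'.
Qed.

(** * Polynomials avoiding a set of variables; substitution for one variable *)

Definition free_of S p : Prop :=
  forall m, m \in msupp p -> forall i, S i -> m i = 0%N.

Lemma free_ofD S p1 p2 : free_of S p1 -> free_of S p2 -> free_of S (p1 + p2).
Proof.
by move=> S1 S2 m /msuppD_le; rewrite mem_cat => /orP[/S1|/S2].
Qed.

Lemma free_ofM S p1 p2 : free_of S p1 -> free_of S p2 -> free_of S (p1 * p2).
Proof.
move=> S1 S2 m /msuppM_le /allpairsP[[m1 m2] /= [/S1 Sm1 /S2 Sm2 ->]] i Si.
by rewrite mnmDE Sm1 ?Sm2.
Qed.

Lemma free_ofC S c : free_of S c%:MP.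
Proof.
move=> m; rewrite msuppC; case: (c == 0) => //; rewrite inE => /eqP -> i _.
exact: mnm0E.
Qed.

Lemma free_ofN S p : free_of S p -> free_of S (- p).
Proof. by move=> Sp m; rewrite (perm_mem (msuppN p)); apply: Sp. Qed.

Lemma free_of_exp S p k : free_of S p -> free_of S (p ^+ k).
Proof.
move=> Sp; elim: k => [|k IH]; first by rewrite expr0; apply: free_ofC.
by rewrite exprS; apply: free_ofM.
Qed.

Lemma free_ofX S i : ~ S i -> free_of S 'X_i.
Proof.
move=> nSi m; rewrite msuppX inE => /eqP -> j Sj; rewrite mnm1E.
by case: eqP => // ij; case: nSi; rewrite ij.
Qed.

Lemma free_of_sub S S' p :
  (forall i, S' i -> S i) -> free_of S p -> free_of S' p.
Proof. by move=> sub Sp m mp i /sub; apply: Sp. Qed.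

Local Notation subst i t :=
  (comp_mpoly [tuple (if j == i then t else 'X_j) | j < n]).

Lemma substX i t j : subst i t 'X_j = if j == i then t else 'X_j :> R.
Proof. by rewrite comp_mpolyXU -tnth_nth tnth_mktuple. Qed.

(** A variable occurring in [p] is either replaced by [t] or lies outside [S], hence outside
    [S']. *)
Lemma subst_free S S' i t p :
  (forall j, S' j -> j = i \/ S j) -> free_of S p -> free_of S' t ->
  free_of S' (subst i t p).
Proof.
move=> S'S Sp S't; rewrite comp_mpolyE big_seq.
apply: big_ind => [|p1 p2|m mp]; [exact: free_ofC|exact: free_ofD|].
rewrite -mul_mpolyC; apply: free_ofM; first exact: free_ofC.
apply: big_ind => [|p1 p2|j _]; [exact: free_ofC|exact: free_ofM|].
rewrite tnth_mktuple; have [_|/eqP ji] := ifP; first exact: free_of_exp.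
have [-> |mj] := posnP (m j); first by rewrite expr0; apply: free_ofC.
apply/free_of_exp/free_ofX => /S'S[//|Sj].
by move: mj; rewrite (Sp _ mp).
Qed.

Lemma subst_id i t p : free_of (eq i) p -> subst i t p = p.
Proof.
move=> ip; rewrite comp_mpolyE [RHS]mpolyE; apply: eq_big_seq => m mp.
congr (_ *: _); rewrite mpolyXE_id; apply: eq_bigr => j _.
rewrite tnth_mktuple; case: eqP => // ->.
by rewrite (ip _ mp) // !expr0.
Qed.

(** Modulo [J] the substitution fixes every variable, and congruence respects sums and products. *)
Lemma subst_congr J i t p :
  is_ideal J -> J ('X_i - t) -> J (p - subst i t p).
Proof.
move=> idJ Jit; have [J0 JD JM] := idJ.
have Jmul (a b a' b' : R) : J (a - b) -> J (a' - b') -> J (a * a' - b * b').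
  move=> Jab Jab'; rewrite -(subrK (a * b') (a * a')) -addrA -mulrBr -mulrBl.
  by apply: JD; [apply: JM|rewrite mulrC; apply: JM].
rewrite comp_mpolyE {1}[p]mpolyE -sumrB; apply: ideal_sum => // m _.
rewrite -scalerBr -mul_mpolyC; apply: JM; rewrite mpolyXE_id.
apply: (big_ind2 (fun a b => J (a - b))) => [|a a' b b'|j _].
- by rewrite subrr.
- exact: Jmul.
rewrite tnth_mktuple; elim: (m j) => [|k IH]; first by rewrite !expr0 subrr.
rewrite !exprS; apply: Jmul => //.
by case: eqP => [-> //|_]; rewrite subrr.
Qed.

(* The inclusion of the polynomials free of S induces isomorphisms from one    *)
(* common quotient ring to R/J and R/L.                                        *)
Definition agree_off S J L : Prop :=
  [/\ forall p, free_of S p -> J p <-> L p,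
      forall p, exists2 p', free_of S p' & J (p - p')
    & forall p, exists2 p', free_of S p' & L (p - p')].

(** The cofactor [g] may be replaced by a congruent one free of [S]; its product with [f] is then
    free of [S] too, where the two ideals agree. *)
Lemma regular_agree S J L f : is_ideal J -> is_ideal L ->
  agree_off S J L -> free_of S f -> regular_on J f <-> regular_on L f.
Proof.
have aux (J1 J2 : R -> Prop) : is_ideal J1 -> is_ideal J2 ->
    (forall p, free_of S p -> J1 p <-> J2 p) ->
    (forall p, exists2 p', free_of S p' & J2 (p - p')) -> free_of S f ->
    regular_on J1 f -> regular_on J2 f.
  move=> id1 id2 J12 ex2 Sf [vf regf]; split=> // g J2fg.
  have [g' Sg' J2g] := ex2 g; apply/(ideal_congr id2 J2g)/J12/regf/J12 => //.
    exact: free_ofM.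
  have J2fgg' : J2 (f * g - f * g') by rewrite -mulrBr; case: id2 => _ _; apply.
  exact/(ideal_congr id2 J2fgg').
move=> idJ idL [JL exJ exL] Sf; split; apply: aux => // p Sp.
exact: iff_sym (JL p Sp).
Qed.

(** * Elimination of X_i modulo X_i + X_j *)

Section Elimination.
Variables (i j : 'I_n).
Hypothesis i_gt_j : var_gt le i j.
Local Notation f := ('X_i + 'X_j : R).
Local Notation phi := (subst i (- 'X_j : R)).

Let move_var m : 'X_{1..n} := (m - U_(i) *+ m i + U_(j) *+ m i)%MM.

Lemma mnm_split_var m : (m = m - U_(i) *+ m i + U_(i) *+ m i)%MM.
Proof.
rewrite submK //; apply/mnm_lepP => k; rewrite mulmnE mnm1E.
by case: eqP => [->|_]; rewrite ?mul1n ?mul0n.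
Qed.

Lemma elim_monomial m : phi 'X_[m] = (-1) ^+ m i *: 'X_[move_var m].
Proof.
rewrite {1}[m]mnm_split_var mpolyXD rmorphM /= subst_id; last first.
  move=> m'; rewrite msuppX inE => /eqP -> _ <-.
  by rewrite mnmBE mulmnE mnm1E eqxx mul1n subnn.
rewrite -mpolyXn rmorphXn /= substX eqxx [(- 'X_j) ^+ _]exprNn mpolyXn mulrCA -mpolyXD.
by rewrite -signr_odd -[in RHS]signr_odd; case: odd;
   rewrite ?expr1 ?expr0 ?mulN1r ?scaleN1r ?mul1r ?scale1r.
Qed.

(** The factors X_i are traded one at a time for the smaller X_j. *)
Lemma le_move_var m : le (move_var m) m.
Proof.
case: le_term_order => -[le_refl _ le_trans _] leD _.
rewrite {2}[m]mnm_split_var; apply: (leD).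
elim: (m i) => [|k IH]; first by rewrite !mulm0n; apply: le_refl.
rewrite !mulmS; apply: (le_trans (U_(i) + U_(j) *+ k)%MM).
  by rewrite ![(_ + U_(j) *+ k)%MM]addmC; apply: (leD); case: i_gt_j.
exact: (leD).
Qed.

(* A monomial of [p] other than [m] is smaller than [m], and substituting     *)
(* [- X_j] for [X_i] can only make it smaller still, so nothing cancels [m].  *)
Lemma initial_elim p m :
  initial_monomial le p m -> m i = 0%N -> m \in msupp (phi p).
Proof.
case: le_term_order => -[_ le_anti le_trans _] _ _ [mp max_m] mi.
have move_m : move_var m = m.
  by rewrite /move_var mi !mulm0n addm0 subm0.
have -> : phi p = \sum_(m' <- msupp p) p@_m' *: phi 'X_[m'].
  rewrite {1}[p]mpolyE raddf_sum; apply: eq_bigr => m' _.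
  exact: comp_mpolyZ.
rewrite mcoeff_msupp raddf_sum /= (bigD1_seq m) ?msupp_uniq //=.
rewrite big1_seq => [|m' /andP[m'm m'p]].
  rewrite elim_monomial mi expr0 scale1r move_m addr0 mcoeffZ mcoeffX eqxx.
  by rewrite mulr1 -mcoeff_msupp.
rewrite elim_monomial !mcoeffZ mcoeffX.
case: eqP => [m'E|_]; last by rewrite !mulr0.
case/eqP: m'm; apply: le_anti; rewrite max_m //=.
by rewrite -{1}m'E le_move_var.
Qed.

Variable L : R -> Prop.
Hypothesis L_monomial : monomial_ideal L.
Local Notation A := (ideal_adjoin L [:: f]).

Lemma elim_congr p : A (p - phi p).
Proof.
apply: subst_congr; first exact: ideal_adjoin_is_ideal.
by rewrite opprK; apply: mem_ideal_gen; right; rewrite inE.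
Qed.

(** The [p] with this property form an ideal, so generators of [A] suffice: [phi] kills [f], and
    sends a monomial of [L] to a signed monomial congruent to it modulo [A]. *)
Lemma adjoin_elim_supp p m : A p -> m \in msupp (phi p) -> A 'X_[m].
Proof.
have idA := ideal_adjoin_is_ideal L [:: f].
have [P0 PD PM] := supp_ideal idA; move=> Ap; move: m.
have idP : is_ideal (fun p => forall m, m \in msupp (phi p) -> A 'X_[m]).
  split=> [|p1 p2|p1 p2]; first by rewrite raddf0; apply: P0.
    by rewrite raddfD; apply: PD.
  by rewrite rmorphM; apply: PM.
move: Ap; apply: (ideal_gen_min idP) => g [Lg|]; last first.
  rewrite inE => /eqP ->; rewrite raddfD /= !substX eqxx.
  by case: i_gt_j => _ /negPf; rewrite eq_sym => ->; rewrite addNr; apply: P0.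
apply: (ideal_supp idP) => m0 m0g m; rewrite elim_monomial => /msuppZ_le.
rewrite msuppX inE => /eqP ->.
suff: A ((-1) ^+ m0 i *: 'X_[move_var m0]).
  case: (idA) => _ _ AM /(AM ((-1) ^+ m0 i)%:MP).
  by rewrite mul_mpolyC scalerA -expr2 sqrr_sign scale1r.
rewrite -elim_monomial; apply/(ideal_congr idA (elim_congr 'X_[m0])).
by apply: mem_ideal_gen; left; apply: monomial_ideal_supp Lg m0g.
Qed.

(** If [p] is in [A], then [p = phi p] has all its monomials in [A], hence in the initial ideal.
    Conversely, a monomial of [p] in the initial ideal is divisible by the initial monomial [m0] of
    some [P] in [A]; [m0] is free of X_i, so it survives in [phi P] and therefore lies in [A]. *)
Lemma initial_adjoin p :
  free_of (eq i) p -> A p <-> initial_ideal le A p.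
Proof.
move=> ip; have idA := ideal_adjoin_is_ideal L [:: f].
have [_ _ AM] := idA; split=> [Ap|inp].
  apply: ideal_supp; first exact: ideal_gen_is_ideal.
  move=> m mp; apply: initial_ideal_mem_monomial.
  by apply: (adjoin_elim_supp Ap); rewrite subst_id.
apply: ideal_supp => // m mp.
have : exists2 m0, (exists2 P, A P & initial_monomial le P m0) & (m0 <= m)%MM.
  apply: (mem_gen_monomials _ mp).
  apply: ideal_gen_min inp; first exact: ideal_gen_is_ideal.
  move=> _ [P [m0 [AP inP ->]]]; apply: mem_ideal_gen.
  by exists m0 => //; exists P.
case=> m0 [P AP inP] le0; rewrite -(submK le0) mpolyXD; apply: AM.
apply: (adjoin_elim_supp AP); apply: initial_elim => //.
by apply/eqP; rewrite -leqn0 -(ip _ mp i erefl); apply/mnm_lepP.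
Qed.

Lemma var_initial_adjoin : initial_ideal le A 'X_i.
Proof.
case: le_term_order => -[le_refl _ _ _] _ _; case: i_gt_j => le_ji ij.
apply: mem_ideal_gen; exists f, U_(i)%MM; split=> //.
  by apply: mem_ideal_gen; right; rewrite inE.
split=> [|m /msuppD_le].
  rewrite mcoeff_msupp mcoeffD !mcoeffXU eqxx [j == i]eq_sym (negPf ij) addr0.
  exact: oner_neq0.
by rewrite mem_cat !msuppX !inE => /orP[]/eqP ->.
Qed.

Lemma sub_initial_adjoin p : L p -> initial_ideal le A p.
Proof.
move=> Lp; apply: ideal_supp; first exact: ideal_gen_is_ideal.
move=> m mp; apply: initial_ideal_mem_monomial.
by apply: mem_ideal_gen; left; apply: monomial_ideal_supp mp.
Qed.

(** Off [S], agreement of [J] and [L] passes to (J, f) and (L, f); off X_i as well, [initial_adjoin]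
    replaces (L, f) by its initial ideal. *)
Lemma agree_step S S' J : is_ideal J -> agree_off S J L ->
  ~ S i -> ~ S j -> (forall k, S' k <-> k = i \/ S k) ->
  agree_off S' (ideal_adjoin J [:: f]) (initial_ideal le A).
Proof.
move=> idJ [JL exJ exL] nSi nSj S'E.
have idL := monomial_ideal_is_ideal L_monomial.
have idA' := ideal_adjoin_is_ideal J [:: f].
have idin : is_ideal (initial_ideal le A) by apply: ideal_gen_is_ideal.
have Sf : free_of S f by apply: free_ofD; apply: free_ofX.
have S'j : free_of S' 'X_j.
  apply: free_ofX => /S'E[ji|//]; case: i_gt_j => _ /eqP; exact.
(* The coefficient [h] of [f] is replaced by a congruent [h'] free of [S], so that [p - h' * f] is
   tested where [J1] and [J2] agree. *)
have adj (J1 J2 : R -> Prop) p : is_ideal J1 -> is_ideal J2 ->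
    (forall p, free_of S p -> J1 p <-> J2 p) ->
    (forall p, exists2 p', free_of S p' & J1 (p - p')) -> free_of S p ->
    ideal_adjoin J1 [:: f] p -> ideal_adjoin J2 [:: f] p.
  move=> id1 id2 J12 ex1 Sp /(ideal_adjoin1 _ _ id1)[h J1h].
  have [h' Sh' J1hh'] := ex1 h; apply/(ideal_adjoin1 _ _ id2); exists h'.
  apply/J12; first by apply: free_ofD => //; apply: free_ofN; apply: free_ofM.
  suff J1d : J1 ((p - h * f) - (p - h' * f)) by apply/(ideal_congr id1 J1d).
  have -> : (p - h * f) - (p - h' * f) = - f * (h - h') by ring.
  by case: id1 => _ _; apply.
split=> p.
- move=> S'p; have Sp : free_of S p.
    by apply: free_of_sub S'p => k Sk; apply/S'E; right.
  apply: iff_trans (initial_adjoin _).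
    by split; apply: adj => // p' Sp'; exact: iff_sym (JL p' Sp').
  by apply: free_of_sub S'p => k <-; apply/S'E; left.
(* Modulo (J, f), X_i is congruent to - X_j. *)
- have [p' Sp' Jp'] := exJ p; exists (phi p').
    apply: (subst_free (S := S)) => //; first by move=> k /S'E.
    exact: free_ofN.
  have [_ AD _] := idA'; rewrite -(subrK p' p) -addrA; apply: AD.
    by apply: mem_ideal_gen; left.
  apply: subst_congr => //.
  by rewrite opprK; apply: mem_ideal_gen; right; rewrite inE.
(* X_i itself lies in the initial ideal, so here it is replaced by 0. *)
- have [p' Sp' Lp'] := exL p; exists (subst i 0 p').
    apply: (subst_free (S := S)) => //; first by move=> k /S'E.
    exact: free_ofC.
  have [_ inD _] := idin; rewrite -(subrK p' p) -addrA; apply: inD.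
    exact: sub_initial_adjoin.
  by apply: subst_congr => //; rewrite subr0; apply: var_initial_adjoin.
Qed.

End Elimination.
End Monomials.

(** * Induction along the sequence *)

Lemma msize_gt1 (F : fieldType) (n : nat) (p : {mpoly F[n]}) (i : 'I_n) :
  p@_U_(i) != 0 -> (1 < msize p)%N.
Proof. by rewrite -mcoeff_msupp => /msize_mdeg_lt; rewrite mdeg1. Qed.

(* q and r are shifted by one: there are q pairs (x_i, y_i) and r + 1         *)
(* variables c_j, and the sequence has length q + 1.  The only variable that  *)
(* the x's and y's may share with the c's is c_1, and only if c_1 is the last *)
(* of the y's.                                                                *)
Theorem corollary2p6 (F : fieldType) (n : nat) (I : {mpoly F[n]} -> Prop)
    (q r : nat) (x y : 'I_q -> 'I_n) (c : 'I_r.+1 -> 'I_n)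
    (le : rel 'X_{1..n})
    (I_monomial : monomial_ideal I)
    (I_proper : ideal_proper I)
    (c_distinct : injective c)
    (B_disjoint_C : forall v : 'I_n,
       v \in codom x ++ codom y -> v \in codom c ->
       v = c ord0 /\ exists2 k : 'I_q, k.+1 = q & y k = c ord0)
    (le_term_order : term_order le)
    (x_gt_y : forall i : 'I_q, var_gt le (x i) (y i))
    (x_decr : forall i j : 'I_q, (i < j)%N -> var_gt le (x i) (x j))
    (c1_max : forall j : 'I_r.+1, j != ord0 -> var_gt le (c ord0) (c j)) :
  regular_sequence I (linear_sums F x y c) <->
  initially_regular_sequence le I (linear_sums F x y c).
Proof.
pose fs := linear_sums F x y c; rewrite -/fs.
have sz_fs : size fs = q.+1.
  by rewrite size_rcons size_map size_enum_ord.
have nth_pair (i : 'I_q) : fs`_i = 'X_(x i) + 'X_(y i).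
  rewrite nth_rcons size_map size_enum_ord ltn_ord.
  by rewrite (nth_map i) ?size_enum_ord // nth_ord_enum.
have nth_last : fs`_q = \sum_(j < r.+1) 'X_(c j).
  by rewrite nth_rcons size_map size_enum_ord ltnn eqxx.
(* For i < k, the equality would give x_i = y_k < x_k < x_i. *)
have x_neq_y (i k : 'I_q) : (i <= k)%N -> x i <> y k.
  case: le_term_order => -[_ le_anti le_trans _] _ _.
  rewrite leq_eqVlt => /orP[/eqP/val_inj ->|lt_ik] xy.
    by case: (x_gt_y k) => _ /eqP; rewrite xy.
  case: (x_decr _ _ lt_ik) => le_ki /eqP; apply.
  have le_ik : le U_(x i)%MM U_(x k)%MM by rewrite xy; case: (x_gt_y k).
  have /mnmP/(_ (x i)) : U_(x i)%MM = U_(x k)%MM.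
    by apply: le_anti; rewrite le_ik.
  by rewrite !mnm1E eqxx; case: eqP => // ->.
(* In the exceptional case c_1 is the last y, so every i is within the bound of [x_neq_y]. *)
have x_notin_c (i : 'I_q) (j : 'I_r.+1) : x i <> c j.
  move=> xc; case: (@B_disjoint_C (x i)).
  - by rewrite mem_cat codom_f.
  - by rewrite xc codom_f.
  move=> [xc0 [k kq yk]]; apply: (x_neq_y i k); last by rewrite yk.
  by rewrite -ltnS kq.
(* [S k] holds the variables eliminated in the first [k] steps; [A k] is (I, f_1, ..., f_k) and
   [L k] is I_(k+1). *)
pose S k v := exists2 i : 'I_q, (i < k)%N & v = x i.
pose A k := ideal_adjoin I (take k fs).
pose L := iterated_initial le I fs.
have idA k : is_ideal (A k) by apply: ideal_adjoin_is_ideal.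
have monL k : monomial_ideal (L k).
  by case: k => [|k]; apply: initial_ideal_monomial.
have idI := monomial_ideal_is_ideal I_monomial.
have agreement k : (k <= q)%N -> agree_off (S k) (A k) (L k).
  elim: k => [_|k IH lt_kq].
    have free0 p : free_of (S 0%N) p by move=> m _ v [].
    split=> p; last 2 first.
    - by exists p => //; rewrite subrr; case: (idA 0%N).
    - exists p => //; rewrite subrr.
      by case: (monomial_ideal_is_ideal (monL 0%N)).
    move=> _; rewrite /A take0; apply: iff_trans (ideal_adjoin_nil _ idI) _.
    exact: iff_sym (initial_monomial_ideal le_term_order _ I_monomial).
  pose i := Ordinal lt_kq.
  have : agree_off (S k.+1) (ideal_adjoin (A k) [:: 'X_(x i) + 'X_(y i)])
      (initial_ideal le (ideal_adjoin (L k) [:: 'X_(x i) + 'X_(y i)])).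
    apply: (agree_step le_term_order (x_gt_y i) (monL k) (idA k)
              (IH (ltnW lt_kq))).
    - move=> [i' lt_i' xi']; case: (x_decr i' i lt_i') => _ /eqP; apply.
      by rewrite xi'.
    - by move=> [i' lt_i' yi']; apply: (x_neq_y i' i) => //; apply: ltnW.
    - move=> v; split=> [[i' lt_i' ->]|].
        move: lt_i'; rewrite ltnS leq_eqVlt => /orP[/eqP ik|lt_i'].
          by left; congr x; apply: val_inj.
        by right; exists i'.
      by case=> [->|[i' lt_i' ->]]; [exists i|exists i' => //; apply: ltnW].
  rewrite -(nth_pair i) => -[eqJL exJ exL].
  (* [L k.+1] adjoins one element to [L k] by definition, whereas [A k.+1] must be regrouped to this
     form. *)
  have AE p : A k.+1 p <-> ideal_adjoin (A k) [:: fs`_k] p.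
    rewrite /A (take_nth 0) ?sz_fs; last exact: leqW.
    exact: ideal_adjoin_rcons.
  split=> [p Sp|p|p]; last exact: exL.
    exact: iff_trans (AE p) (eqJL p Sp).
  by case: (exJ p) => p' Sp' Jp'; exists p' => //; apply/AE.
have free_fs k : (k <= q)%N -> free_of (S k) fs`_k.
  rewrite leq_eqVlt => /orP[/eqP ->|lt_kq].
    rewrite nth_last; apply: big_ind => [|p1 p2|j _].
    - exact: free_ofC.
    - exact: free_ofD.
    by apply: free_ofX => -[i _ /esym/x_notin_c].
  pose i := Ordinal lt_kq; rewrite (nth_pair i).
  apply: free_ofD; apply: free_ofX => -[i' lt_i'].
    by move=> xi'; case: (x_decr i' i lt_i') => _ /eqP; rewrite xi'.
  by move/esym; apply: x_neq_y; apply: ltnW.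
have regE k : (k < size fs)%N ->
    regular_on (A k) fs`_k <-> regular_on (L k) fs`_k.
  rewrite sz_fs ltnS => le_kq; apply: (regular_agree _ _ (agreement k le_kq)) => //.
    exact: monomial_ideal_is_ideal.
  exact: free_fs.
have nonconst f : f \in fs -> (1 < msize f)%N.
  rewrite mem_rcons inE => /orP[/eqP ->|/mapP[i _ ->]].
    apply: (@msize_gt1 _ _ _ (c ord0)); rewrite raddf_sum /= (bigD1 ord0) //=.
    rewrite big1 ?mcoeffXU ?eqxx ?addr0 ?oner_neq0 // => j /negPf j0.
    by rewrite mcoeffXU (inj_eq c_distinct) j0.
  apply: (@msize_gt1 _ _ _ (x i)); rewrite mcoeffD !mcoeffXU eqxx.
  by case: (x_gt_y i) => _ /negPf; rewrite eq_sym => ->; rewrite addr0 oner_neq0.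
split=> [reg|[_ _ reg]]; last by move=> k lt_k; apply/regE/reg.
by split=> // k lt_k; apply/regE/reg.
Qed.
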